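(* Let $1\le n\le N$ be integers, let the order of the keys in the keyring be a uniformly random permutation of $\{1,\dots,N\}$, and let $T_{n,N}$ be the number of trials needed to open all $n$ locks with the key-by-key strategy. Then $$E(T_{n,N})=\frac{n(2N-n+3)}{4}.$$ Moreover, when $N=n$, $$\mathrm{Var}(T_{n,n})=\frac{n(2n+5)(n-1)}{72}.$$
   Context: There are $n$ locks, numbered $1,\dots,n$, and a keyring with $N\ge n$ keys, numbered $1,\dots,N$. For $1\le i\le n$, key $i$ opens lock $i$ and no other lock; keys $n+1,\dots,N$ open no lock. The person opening the locks does not know the numbers of the keys. The initial condition is a permutation $\sigma$ of $\{1,\dots,N\}$, drawn uniformly from the $N!$ permutations: the key in position $j$ of the keyring is key $\sigma(j)$. A trial consists of trying one key in one lock; the trial in which the key opens the lock is counted, and a trial is counted even if its outcome could be deduced in advance. Once a key has opened a lock, both the key and the lock are discarded; the remaining locks are those not discarded. Key-by-key strategy: treat the keys in keyring order (positions $1,2,\dots$). For the current key, try it in the remaining locks one after another in increasing order of lock number, starting from the first remaining lock, stopping when it opens a lock (this lock and key are then discarded) or when all remaining locks have been tried; then pass to the key in the next position. The process stops as soon as all $n$ locks have been opened. $T_{n,N}$ is the total number of trials made. *)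

(* Defs.v *)
From mathcomp Require Import all_boot all_order all_algebra all_fingroup.
From mathcomp Require Import all_classical all_reals all_analysis.

Set Implicit Arguments.
Unset Strict Implicit.
Unset Printing Implicit Defensive.

Local Open Scope ring_scope.
Local Open Scope classical_set_scope.

(* Locks, keys and keyring positions are numbered from 0: the locks are
   'I_n, the keys and the positions are 'I_N. Key k opens lock k when k < n,
   and the keys k >= n open no lock. *)
Definition opens (n N : nat) (k : 'I_N) (l : 'I_n) : bool :=
  (k == l :> nat)%N.

(* Tries key k in the locks of rem, in the order of rem, until it opens one of
   them or rem is exhausted. Returns the number of trials made (including a
   successful one) and the locks left unopened. *)
Fixpoint try_key (n N : nat) (k : 'I_N) (rem : seq 'I_n) : nat * seq 'I_n :=
  if rem is l :: rem' then
    if opens k l then (1%N, rem')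
    else let r := try_key k rem' in (r.1.+1, l :: r.2)
  else (0%N, [::]).

(* Total number of trials when the keys of ks are treated in order against the
   remaining locks rem, stopping as soon as no lock remains. *)
Fixpoint key_by_key (n N : nat) (ks : seq 'I_N) (rem : seq 'I_n) : nat :=
  if ks is k :: ks' then
    if rem is [::] then 0%N
    else let r := try_key k rem in (r.1 + key_by_key ks' r.2)%N
  else 0%N.

(* enum lists 'I_N and 'I_n in increasing order; the key in position j of the
   keyring is s j. *)
Definition trials (n N : nat) (s : 'S_N) : nat :=
  key_by_key [seq s j | j <- enum 'I_N] (enum 'I_n).

(* sigma is a random permutation, uniform over the N! permutations. As 'S_N is
   finite, its measurability is that of the events sigma = s. *)
Definition uniform_perm (d : measure_display) (Omega : measurableType d)
    (R : realType) (P : probability Omega R) (N : nat)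
    (sigma : Omega -> 'S_N) : Prop :=
  forall s : 'S_N,
    measurable [set w | sigma w = s] /\
    P [set w | sigma w = s] = ((N`!)%:R^-1 : R)%:E.

(* Main.v *)
(* Conditioning on the position i of key 0: that key opens lock 0 at the
   (i+1)-st trial of lock 0, because each of the i keys before it is tried first
   in lock 0. Apart from these i+1 trials the process is the one for n-1 locks
   and N-1 keys, in the order t induced on the other keys. As sigma is uniform,
   i is uniform and independent of t, so mean and variance are computed by
   induction. *)
Require Import Defs.
From mathcomp Require Import all_boot all_order all_algebra all_fingroup.
From mathcomp Require Import all_classical all_reals all_analysis.
From mathcomp Require Import measurable_realfun ring.

Set Implicit Arguments.
Unset Strict Implicit.
Unset Printing Implicit Defensive.

Import Order.TTheory GRing.Theory Num.Theory.

Local Open Scope ring_scope.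

Lemma key_by_key_nil n N (ks : seq 'I_N) :
  key_by_key ks ([::] : seq 'I_n) = 0%N.
Proof. by case: ks. Qed.

Lemma key_by_key_cons n N (k : 'I_N) ks (rem : seq 'I_n) :
  key_by_key (k :: ks) rem =
  ((try_key k rem).1 + key_by_key ks (try_key k rem).2)%N.
Proof. by case: rem => [|l rem] //=; rewrite key_by_key_nil. Qed.

Lemma try_key_lift n N (k : 'I_N) (rem : seq 'I_n) :
  try_key (lift ord0 k) [seq lift ord0 l | l <- rem] =
  ((try_key k rem).1, [seq lift ord0 l | l <- (try_key k rem).2]).
Proof.
elim: rem => [//|l rem IH] /=.
by rewrite /opens /= /bump !leq0n !add1n eqSS; case: eqP => //= _; rewrite IH.
Qed.

Lemma key_by_key_lift n N (ks : seq 'I_N) (rem : seq 'I_n) :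
  key_by_key [seq lift ord0 k | k <- ks] [seq lift ord0 l | l <- rem] =
  key_by_key ks rem.
Proof.
elim: ks rem => [//|k ks IH] rem.
by rewrite map_cons !key_by_key_cons try_key_lift /= IH.
Qed.

(** Each key of [ks1], once lifted, fails first at lock 0 and so costs one extra trial; [ord0] then
    costs one. Lock 0 stays until [ord0] is tried, so these trials are made even if no other lock
    remains. *)
Lemma key_by_key_ord0 n N (ks1 ks2 : seq 'I_N) (rem : seq 'I_n) :
  key_by_key ([seq lift ord0 k | k <- ks1] ++
              ord0 :: [seq lift ord0 k | k <- ks2])
    (ord0 :: [seq lift ord0 l | l <- rem]) =
  ((size ks1).+1 + key_by_key (ks1 ++ ks2) rem)%N.
Proof.
elim: ks1 rem => [|k ks1 IH] rem; first by rewrite /= key_by_key_lift.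
rewrite map_cons !cat_cons !key_by_key_cons /= try_key_lift /= IH.
by rewrite !addSn addnS addnCA.
Qed.

Lemma enum_ord_lift N (i : 'I_N.+1) :
  enum 'I_N.+1 = [seq lift i k | k <- take i (enum 'I_N)] ++
                 i :: [seq lift i k | k <- drop i (enum 'I_N)].
Proof.
have leiN : (i <= N)%N by rewrite -ltnS.
(* On underlying naturals the enumerations become [iota] and [lift i] becomes [bump i], which fixes
   the numbers below [i] and adds one to the others. *)
apply: (inj_map val_inj); rewrite val_enum_ord map_cat map_cons -!map_comp.
have lift_val (s : seq 'I_N) :
  map (val \o lift i) s = map (bump i) (map val s) by rewrite -map_comp.
rewrite !lift_val map_take map_drop val_enum_ord take_iota drop_iota add0n.
rewrite (minn_idPl leiN) -{1}(subnKC (leqW leiN)) iotaD add0n subSn //=.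
congr (_ ++ _ :: _).
  rewrite -[LHS]map_id; apply/eq_in_map => k; rewrite mem_iota add0n /= => ki.
  by rewrite /bump leqNgt ki.
rewrite -[i.+1]add1n iotaDl; apply/eq_in_map => k; rewrite mem_iota => /andP[ik _].
by rewrite /bump ik.
Qed.

(** [lift_perm i ord0 t] puts key 0 in position [i] and keeps the others in the order [t]; splitting
    the positions at [i] reduces the claim to [key_by_key_ord0]. *)
Lemma trials_lift_perm n N (i : 'I_N.+1) (t : 'S_N) :
  trials n.+1 (lift_perm i ord0 t) = (i.+1 + trials n t)%N.
Proof.
have ord0_enum : enum 'I_n.+1 = ord0 :: [seq lift ord0 l | l <- enum 'I_n].
  by rewrite (enum_ord_lift ord0) take0 drop0.
have lift_map s : [seq lift_perm i ord0 t j | j <- [seq lift i k | k <- s]] =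
                  [seq lift ord0 j | j <- [seq t k | k <- s]].
  by rewrite -!map_comp; apply: eq_map => k /=; rewrite lift_perm_lift.
rewrite /trials (enum_ord_lift i) map_cat /= lift_perm_id !lift_map ord0_enum.
rewrite key_by_key_ord0 -map_cat cat_take_drop size_map size_take size_enum_ord.
by rewrite -/(minn _ _) (minn_idPl _) // -ltnS.
Qed.

Lemma trials0 N (s : 'S_N) : trials 0 s = 0%N.
Proof. by rewrite /trials (size0nil (size_enum_ord 0)) key_by_key_nil. Qed.

(** This encodes the uniformity and independence of [i] and [t]: the map from pairs to permutations
    is injective, as [i] is the preimage of [j], and both sides have [N.+1]! elements. *)
Lemma big_lift_perm (V : nmodType) N (F : 'S_N.+1 -> V) (j : 'I_N.+1) :
  \sum_s F s = \sum_(i < N.+1) \sum_(t : 'S_N) F (lift_perm i j t).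
Proof.
rewrite pair_big /= (reindex (fun p : 'I_N.+1 * 'S_N => lift_perm p.1 j p.2)) //=.
apply/onW_bij/inj_card_bij; last by rewrite card_prod !card_Sn card_ord factS.
move=> [i t] [i' t'] /= eq_lift.
have eq_i : i = i'.
  by apply: (@perm_inj _ (lift_perm i j t)); rewrite {2}eq_lift !lift_perm_id.
subst i'; congr (_, _); apply/permP => k.
by apply: (@lift_inj _ j); rewrite -!(lift_perm_lift i) eq_lift.
Qed.

Section Moments.
Variable R : realFieldType.

Definition mean_trials (n N : nat) : R := n%:R * (2 * N%:R - n%:R + 3) / 4.

Definition var_trials (n : nat) : R :=
  n%:R * (2 * n%:R + 5) * (n%:R - 1) / 72.

Lemma sum_natrS N : \sum_(i < N) i.+1%:R = N%:R * (N%:R + 1) / 2 :> R.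
Proof.
elim: N => [|N IH]; first by rewrite big_ord0 !mul0r.
by rewrite big_ord_recr /= IH -natr1; field.
Qed.

Lemma sum_natrS_sqr N :
  \sum_(i < N) i.+1%:R ^+ 2 = N%:R * (N%:R + 1) * (2 * N%:R + 1) / 6 :> R.
Proof.
elim: N => [|N IH]; first by rewrite big_ord0 !mul0r.
by rewrite big_ord_recr /= IH -natr1; field.
Qed.

(** Averaging [i.+1] over the [N.+1] positions adds (N+2)/2 to the mean at each step; [n] and [N]
    decrease together. *)
Lemma sum_trials n N : (n <= N)%N ->
  \sum_(s : 'S_N) (trials n s)%:R = N`!%:R * mean_trials n N.
Proof.
elim: n N => [|n IH] [|N] // lenN.
- by rewrite big1 => [|s _]; rewrite ?trials0 // /mean_trials !mul0r mulr0.
- by rewrite big1 => [|s _]; rewrite ?trials0 // /mean_trials !mul0r mulr0.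
rewrite (big_lift_perm _ ord0).
under eq_bigr => i _.
  under eq_bigr do rewrite trials_lift_perm natrD.
  rewrite big_split /= IH // sumr_const card_Sn -[_ *+ N`!]mulr_natl; over.
rewrite big_split /= -mulr_sumr sum_natrS sumr_const card_ord -[_ *+ N.+1]mulr_natl.
by rewrite factS natrM /mean_trials -!natr1; field.
Qed.

(** The variance increases at each step by that of a uniform variable on 1, ..., n+1, namely
    n(n+2)/12. *)
Lemma sum_trials_centered_sqr n :
  \sum_(s : 'S_n) ((trials n s)%:R - mean_trials n n) ^+ 2 =
  n`!%:R * var_trials n.
Proof.
elim: n => [|n IH].
  rewrite big1 => [|s _]; first by rewrite /var_trials !mul0r mulr0.
  by rewrite trials0 /mean_trials !mul0r subrr expr0n.
(* This kills the cross term of the square expanded below. *)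
have sum_centered :
    \sum_(s : 'S_n) ((trials n s)%:R - mean_trials n n) = 0.
  by rewrite sumrB sum_trials // sumr_const card_Sn mulr_natl subrr.
rewrite (big_lift_perm _ ord0).
(* [c] is the mean of [i.+1] over ['I_n.+1], and also the difference of the two consecutive
   means. *)
pose c : R := (n%:R + 2) / 2.
have split_sqr (i : 'I_n.+1) (t : 'S_n) :
  ((trials n.+1 (lift_perm i ord0 t))%:R - mean_trials n.+1 n.+1) ^+ 2 =
  (i.+1%:R - c) ^+ 2 +
  (2 * (i.+1%:R - c) * ((trials n t)%:R - mean_trials n n) +
   ((trials n t)%:R - mean_trials n n) ^+ 2).
  by rewrite trials_lift_perm natrD /c /mean_trials -!natr1; field.
under eq_bigr => i _.
  under eq_bigr do rewrite split_sqr.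
  rewrite !big_split /= IH sumr_const card_Sn -[_ *+ n`!]mulr_natl.
  rewrite -[X in _ + (X + _)]mulr_sumr sum_centered mulr0 add0r; over.
have sum_c : \sum_(i < n.+1) (i.+1%:R - c) ^+ 2 =
    n%:R * (n%:R + 1) * (n%:R + 2) / 12.
  under eq_bigr => i _ do rewrite sqrrB -mulrnAr.
  rewrite big_split sumrB /= sum_natrS_sqr -mulr_suml sum_natrS sumr_const.
  by rewrite card_ord -[_ *+ n.+1]mulr_natl -[c *+ 2]mulr_natl /c -natr1; field.
rewrite big_split /= -mulr_sumr sum_c sumr_const card_ord -[_ *+ n.+1]mulr_natl.
by rewrite factS natrM /var_trials -natr1; field.
Qed.

End Moments.

(** The integrand is a finite combination of indicators of the events [sigma w = s], each of
    probability 1/N!. Nonnegativity of [g] lets the integral pass through the sum and the constant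
    factors. *)
Lemma expectation_uniform_perm (d : measure_display) (Omega : measurableType d)
    (R : realType) (P : probability Omega R) (N : nat) (sigma : Omega -> 'S_N)
    (g : 'S_N -> R) :
  uniform_perm P sigma -> (forall s, 0 <= g s) ->
  ('E_P[fun w => g (sigma w)] = (N`!%:R^-1 * \sum_s g s)%:E)%E.
Proof.
move=> usigma g0.
pose A s := [set w | sigma w = s]%classic.
have mA s : measurable (A s) by case: (usigma s).
have gE w : (g (sigma w))%:E = (\sum_s (g s)%:E * (\1_(A s) w)%:E)%E.
  rewrite (bigD1 (sigma w)) //= big1 => [|s sw].
    by rewrite indicE mem_set // mule1 adde0.
  by rewrite indicE memNset ?mule0 // => /esym/eqP; rewrite (negPf sw).
rewrite unlock; under eq_integral do rewrite /= gE.
rewrite ge0_integral_sum //; last 2 first.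
- move=> s; apply: measurable_funeM; apply/measurable_EFinP.
  exact: measurable_indic.
- by move=> s w _; rewrite mule_ge0 // lee_fin.
rewrite mulr_sumr -sumEFin; apply: eq_bigr => s _.
rewrite ge0_integralZl ?lee_fin //; last first.
  by apply/measurable_EFinP; exact: measurable_indic.
rewrite integral_indic // setIT mulrC EFinM.
by congr (_ * _)%E; case: (usigma s).
Qed.

Theorem mainTheorem4 (d : measure_display) (Omega : measurableType d)
    (R : realType) (P : probability Omega R) (n N : nat)
    (sigma : Omega -> 'S_N)
    (hn : (1 <= n)%N) (hnN : (n <= N)%N) (hsigma : uniform_perm P sigma) :
  ('E_P[fun w => (trials n (sigma w))%:R]
     = ((n%:R * (2 * N%:R - n%:R + 3) / 4 : R)%:E))%E /\
  (N = n ->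
   ('V_P[fun w => (trials n (sigma w))%:R]
     = ((n%:R * (2 * n%:R + 5) * (n%:R - 1) / 72 : R)%:E))%E).
Proof.
have fact_neq0 k : k`!%:R != 0 :> R by rewrite pnatr_eq0 -lt0n fact_gt0.
have mean :
    ('E_P[fun w => (trials n (sigma w))%:R] = (mean_trials R n N)%:E)%E.
  rewrite (expectation_uniform_perm (g := fun s => (trials n s)%:R)) //.
  by rewrite sum_trials // mulKf.
split=> [|eqNn]; first exact: mean.
(* Unfolded, the variance is the expectation of the centered variable times itself, convertible to
   the square in [g]. *)
subst N; rewrite /variance unlock mean.
rewrite (expectation_uniform_perm
  (g := fun s => ((trials n s)%:R - mean_trials R n n) ^+ 2)) // => [|s].
  by rewrite sum_trials_centered_sqr mulKf.
exact: sqr_ge0.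
Qed.
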